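(* Let $\lambda=(\lambda_n)$ be a frequency containing arbitrarily large arithmetic progressions, and let $1\le p\le\infty$. Then $\mathcal B=\{e^{-\lambda_n s}\}$ in $\mathcal H_p^\lambda$ is suppression unconditional for constant coefficients (SUCC) if and only if $p=2$.
   Context: A frequency is a strictly increasing unbounded sequence $\lambda=(\lambda_n)_{n\ge1}$ of non-negative real numbers. It contains arbitrarily large arithmetic progressions if for every $N\in\mathbb N$ there are $a,b\in\mathbb R$ with $b>0$ such that $\{a+kb:k=1,\dots,N\}\subset\{\lambda_n:n\in\mathbb N\}$. A $\lambda$-Dirichlet polynomial is a finite sum $D=\sum_{n\in A}a_n e^{-\lambda_n s}$, with $A\subset\mathbb N$ finite and $a_n\in\mathbb C$. Its norms are $\|D\|_{\mathcal H_p^\lambda}=\lim_{R\to\infty}\big(\frac1{2R}\int_{-R}^R|\sum_{n\in A}a_n e^{-\lambda_n it}|^p\,dt\big)^{1/p}$ for $1\le p<\infty$ and $\|D\|_{\mathcal H_\infty^\lambda}=\sup_{t\in\mathbb R}|\sum_{n\in A}a_n e^{-i\lambda_n t}|$. For $1\le p<\infty$, $\mathcal H_p^\lambda$ is the completion of the space of $\lambda$-Dirichlet polynomials under $\|\cdot\|_{\mathcal H_p^\lambda}$; for $p=\infty$, $\mathcal B$ is regarded as a basis of the completion $\mathcal A_\infty^\lambda$ of the $\lambda$-Dirichlet polynomials under $\|\cdot\|_{\mathcal H_\infty^\lambda}$. For a finite set $A\subset\mathbb N$ let $\mathcal E_A$ be the set of families $\varepsilon=(\varepsilon_n)_{n\in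 A}$ of complex numbers with $|\varepsilon_n|=1$, and for $\varepsilon\in\mathcal E_A$ put $\mathbf 1_{\varepsilon,A}=\sum_{n\in A}\varepsilon_n e^{-\lambda_n s}$. $\mathcal B$ is SUCC in $\mathcal H_p^\lambda$ if there is $C>0$ such that $\|\mathbf 1_{\varepsilon,A}\|_{\mathcal H_p^\lambda}\le C\|\mathbf 1_{\tilde\varepsilon,B}\|_{\mathcal H_p^\lambda}$ for all finite sets $A\subset B\subset\mathbb N$ and all $\varepsilon\in\mathcal E_A$, $\tilde\varepsilon\in\mathcal E_B$. *)

(* Defs.v *)
From mathcomp Require Import all_boot all_order all_algebra.
From mathcomp Require Import finmap complex.
From mathcomp Require Import all_classical all_reals all_analysis.

Set Implicit Arguments.
Unset Strict Implicit.
Unset Printing Implicit Defensive.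

Import Order.TTheory GRing.Theory Num.Theory.
Import numFieldNormedType.Exports.

Local Open Scope classical_set_scope.
Local Open Scope ring_scope.
Local Open Scope complex_scope.

(* Frequencies are indexed from 0: [lam n] is lambda_{n+1}. *)
Definition frequency (R : realType) (lam : nat -> R) : Prop :=
  [/\ forall n, 0 <= lam n,
      forall m n, (m < n)%N -> lam m < lam n &
      forall M, exists n, M < lam n].

Definition large_arithmetic_progressions (R : realType) (lam : nat -> R) : Prop :=
  forall N : nat, exists a b : R, 0 < b /\
    [set a + k%:R * b | k in [set k : nat | (1 <= k <= N)%N]] `<=` range lam.

Definition cexp (R : realType) (z : R[i]) : R[i] :=
  (expR (complex.Re z))%:C * (cos (complex.Im z) +i* sin (complex.Im z)).

Definition cmod (R : realType) (z : R[i]) : R := complex.Re `|z|.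

(* Only the values of [a] on [A] matter. *)
Definition dirichlet_poly (R : realType) (lam : nat -> R) (A : {fset nat})
    (a : nat -> R[i]) (s : R[i]) : R[i] :=
  \sum_(n <- A) a n * cexp (- (lam n)%:C * s).

(* The norm is only meaningful for 1 <= p <= +oo; [-oo] gets a dummy value. *)
Definition Hnorm (R : realType) (p : \bar R) (D : R[i] -> R[i]) : R :=
  match p with
  | r%:E => lim ((((2 * T)^-1 *
        \int[lebesgue_measure]_(t in `[- T, T]) (cmod (D (0 +i* t)) `^ r))
          `^ r^-1) @[T --> +oo%R])
  | +oo%E => sup (range (fun t : R => cmod (D (0 +i* t))))
  | -oo%E => 0
  end.

Definition unimodular_on (R : realType) (A : {fset nat}) (eps : nat -> R[i])
    : Prop :=
  forall n, n \in A -> cmod (eps n) = 1.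

Definition SUCC (R : realType) (lam : nat -> R) (p : \bar R) : Prop :=
  exists C : R, 0 < C /\
    forall (A B : {fset nat}) (eps eps' : nat -> R[i]),
      (A `<=` B)%fset -> unimodular_on A eps -> unimodular_on B eps' ->
      Hnorm p (dirichlet_poly lam A eps) <=
        C * Hnorm p (dirichlet_poly lam B eps').

(* Main.v *)
Require Import Defs.
From mathcomp Require Import all_boot all_order all_algebra.
From mathcomp Require Import finmap complex ring lra.
From mathcomp Require Import all_classical all_reals all_analysis.

(** For [p = 2] the norm of a Dirichlet polynomial is the l2 norm of its
    coefficients, because distinct frequencies are orthogonal for the Bohr mean
    ([mean_value_sqr_cmod]).  A unimodular sum over [A] thus has norm
    [sqrt #|A|], which grows with [A], and SUCC holds with constant 1
    ([SUCC2]).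

    For [p <> 2] everything happens inside an arithmetic progression
    [a + k b] with [N = 2 ^ m] terms.  There the modulus of a Dirichlet
    polynomial at [i t] is that of a polynomial on the unit circle at
    [exp (- i b t)], so it is periodic in [t] and its means of all orders exist
    ([mean_value_periodic], [progression_dirichlet_poly]).  SUCC with [A = B]
    makes the p-norms of any two unimodular polynomials with the same number of
    terms comparable, uniformly in [N].  Two such polynomials are tested against
    each other.

    The Rudin-Shapiro polynomial is flat: its modulus never exceeds
    [sqrt (2 N)], while its mean square is [N].  Hence its mean of order [r]
    is comparable with [N ^ (r / 2)] from above for every [r > 0]
    ([zmean_flat_le]) and from below for [r < 2] ([zmean_flat_ge]).

    The Dirichlet kernel [1 + z + ... + z ^ (N - 1)] also has mean square [N]
    but is peaked near [z = 1].  Consequently its means of orders [r < s]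
    cannot satisfy both a lower bound [c N ^ (r / 2)] and an upper bound
    [B N ^ (s / 2)] ([kernel_powers_not_comparable]).  The reason is a splitting
    of the circle into three parts.  Where the kernel exceeds [K] its power [r]
    is at most [K ^ (r - s)] times its power [s].  Near [z = 1] a Fejer-type
    weight, the squared modulus of the kernel with [M] terms, is large although
    its mean after normalisation is only [4 / M].  Away from [z = 1] the kernel
    is bounded by [4 M].  With [K = k sqrt N], the contributions after division
    by [N ^ (r / 2)] are [B k ^ (r - s)], [4 k ^ r / M] and
    [(4 M) ^ r / N ^ (r / 2)], all small if [k], then [M], then [N] are chosen
    large.

    If SUCC held, the comparison with Rudin-Shapiro would supply exactly those
    two bounds: with [r = 2] and [s = p] when [p > 2], with [r = p] and [s = 2]
    when [p < 2].  For [p = +oo] the kernel takes the value [N] at [t = 0],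
    whereas the Rudin-Shapiro supremum is at most [sqrt (2 N)]. *)

Set Implicit Arguments.
Unset Strict Implicit.
Unset Printing Implicit Defensive.

Import Order.TTheory GRing.Theory Num.Theory.
Import numFieldNormedType.Exports.

Local Open Scope classical_set_scope.
Local Open Scope ring_scope.
Local Open Scope complex_scope.

(** * Bohr means of continuous functions *)

Section Mean.
Context {R : realType}.
Implicit Types (f g : R -> R) (a b c k w K L : R).

(** Continuity is bundled with the convergence so that integrability on every
    segment is automatic when means are added or compared. *)
Definition mean_value f c : Prop := continuous f /\
  (fun T : R => (2 * T)^-1 * \int[lebesgue_measure]_(t in `[- T, T]) f t)
    @ +oo%R --> c.

Lemma continuous_within_itv f a b : continuous f ->
  {within `[a, b], continuous f}.
Proof. by move=> cf; apply: continuous_subspaceT. Qed.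

Lemma integrable_itv f a b : continuous f ->
  (@lebesgue_measure R).-integrable `[a, b] (EFin \o f).
Proof.
move=> cf; apply: continuous_compact_integrable; first exact: segment_compact.
exact: continuous_within_itv.
Qed.

(** The usual way to produce a mean: an error that stays bounded is killed by
    the factor [1 / (2 T)]. *)
Lemma mean_value_bounded_error f c K : continuous f ->
  (forall T, 0 < T ->
    `|\int[lebesgue_measure]_(t in `[- T, T]) f t - 2 * T * c| <= K) ->
  mean_value f c.
Proof.
move=> cf fK; split=> //; apply/cvgrPdist_le => /= e e0.
near=> T.
have T0 : 0 < T by near: T; apply: nbhs_pinfty_gt; rewrite num_real.
have TK : K / (2 * e) <= T.
  by near: T; apply: nbhs_pinfty_ge; rewrite num_real.
rewrite distrC.
set I := \int[_]_(_ in _) _.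
have -> : (2 * T)^-1 * I - c = (2 * T)^-1 * (I - 2 * T * c).
  by field; lra.
rewrite normrM ger0_norm ?invr_ge0; last by lra.
rewrite ler_pdivrMl; last by lra.
apply: le_trans (fK _ T0) _.
by move: TK; rewrite ler_pdivrMr; lra.
Unshelve. all: by end_near. Qed.

Lemma mean_valueD f g a b : mean_value f a -> mean_value g b ->
  mean_value (fun t => f t + g t) (a + b).
Proof.
move=> [cf fa] [cg gb]; split.
  by move=> x; apply: cvgD; [apply: cf|apply: cg].
apply: (cvg_trans _ (cvgD fa gb)); apply: near_eq_cvg; near=> T.
rewrite /= -mulrDr RintegralD//; exact: integrable_itv.
Unshelve. all: by end_near. Qed.

Lemma mean_valueZ f a k : mean_value f a -> mean_value (fun t => k * f t) (k * a).
Proof.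
move=> [cf fa]; split.
  by move=> x; apply: cvgM; [apply: cvg_cst|apply: cf].
apply: (cvg_trans _ (cvgM (@cvg_cst _ k _ _ _) fa)); apply: near_eq_cvg; near=> T.
rewrite /= mulrCA -RintegralZl//; exact: integrable_itv.
Unshelve. all: by end_near. Qed.

Lemma Rintegral_FTC2 f (F : R -> R) a b : a < b -> continuous f ->
  (forall x : R, is_derive x 1 F (f x)) ->
  \int[lebesgue_measure]_(t in `[a, b]) f t = F b - F a.
Proof.
move=> ab cf dF.
have cF : continuous F.
  by move=> x; apply/differentiable_continuous/derivable1_diffP/ex_derive.
rewrite /Rintegral (@continuous_FTC2 _ _ F)//.
- exact: continuous_within_itv.
- split; first by move=> x _; apply: ex_derive.
  + by apply: cvg_at_right_filter; apply: cF.
  + by apply: cvg_at_left_filter; apply: cF.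
- by move=> x _; rewrite derive1E derive_val.
Qed.

Lemma mean_value_cst k : mean_value (cst k) k.
Proof.
have ck : continuous (cst k : R -> R) by exact: cst_continuous.
have dF (x : R) : is_derive x 1 (fun t : R => k * t) (cst k x).
  by apply: is_derive_eq; rewrite /GRing.scale /= mulr1.
apply: (@mean_value_bounded_error _ _ 0) => // T T0.
rewrite (Rintegral_FTC2 _ ck dF); last by lra.
by rewrite normr_le0; apply/eqP; ring.
Qed.

Lemma mean_value_sum (I : Type) (s : seq I) (F : I -> R -> R) (c : I -> R) (P : pred I) :
  (forall i, P i -> mean_value (F i) (c i)) ->
  mean_value (fun t => \sum_(i <- s | P i) F i t) (\sum_(i <- s | P i) c i).
Proof.
move=> Fc; elim: s => [|i s IH].
  rewrite big_nil (_ : (fun _ => _) = cst 0); first exact: mean_value_cst.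
  by apply/funext => t; rewrite big_nil.
rewrite big_cons; under eq_fun do rewrite big_cons.
by case: ifP => // Pi; apply: mean_valueD => //; apply: Fc.
Qed.

Lemma mean_value_le f g a b : (forall t, f t <= g t) ->
  mean_value f a -> mean_value g b -> a <= b.
Proof.
move=> fg [cf fa] [cg gb]; apply: (ler_cvg_to fa gb); near=> T.
have T0 : 0 < T by near: T; apply: nbhs_pinfty_gt; rewrite num_real.
rewrite ler_pM2l ?invr_gt0; last by lra.
by apply: le_Rintegral => //; exact: integrable_itv.
Unshelve. all: by end_near. Qed.

(** A nonconstant oscillation has a bounded antiderivative, so its mean
    vanishes; this is the orthogonality of distinct frequencies. *)
Lemma mean_value_trig a b w : w != 0 ->
  mean_value (fun t : R => a * cos (w * t) + b * sin (w * t)) 0.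
Proof.
move=> w0.
pose F (t : R) := a / w * sin (w * t) - b / w * cos (w * t).
have dF (x : R) : is_derive x 1 F (a * cos (w * x) + b * sin (w * x)).
  apply: is_derive_eq.
  by rewrite /GRing.scale /=; field.
have c1 : continuous (fun t : R => a * cos (w * t) + b * sin (w * t)).
  move=> x; apply/differentiable_continuous/derivable1_diffP.
  apply: ex_derive.
apply: (@mean_value_bounded_error _ _ (2 * (`|a / w| + `|b / w|))) => //.
move=> T T0; rewrite (Rintegral_FTC2 _ c1 dF); last by lra.
have FK x : `|F x| <= `|a / w| + `|b / w|.
  apply: le_trans (ler_normB _ _) _; rewrite !(normrM (_ / _)) lerD//.
    by rewrite ler_piMr// sin_max.
  by rewrite ler_piMr// cos_max.
rewrite mulr0 subr0; apply: le_trans (ler_normB _ _) _.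
by have := FK T; have := FK (- T); lra.
Qed.

Lemma Rintegral_split f a b c : continuous f -> a <= b -> b <= c ->
  \int[lebesgue_measure]_(t in `[a, c]) f t =
  \int[lebesgue_measure]_(t in `[a, b]) f t +
  \int[lebesgue_measure]_(t in `[b, c]) f t.
Proof.
move=> cf ab bc.
have := @Rintegral_itvB _ f (BLeft a) (BRight c) b (integrable_itv _ _ cf).
rewrite !bnd_simp => /(_ ab bc).
rewrite Rintegral_itv_obnd_cbnd; last first.
  by apply: integrableS (integrable_itv b c cf) => //; apply: subset_itvr; rewrite bnd_simp.
by move=> <-; rewrite addrC subrK.
Qed.

Lemma Rintegral_shift f a b L : continuous f -> a <= b ->
  \int[lebesgue_measure]_(t in `[a + L, b + L]) f t =
  \int[lebesgue_measure]_(t in `[a, b]) f (t + L).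
Proof.
move=> cf ab.
pose F x : R := x + L.
have dF (x : R) : is_derive x 1 F 1.
  by apply: is_derive_eq; rewrite addr0.
have dF1 : derive1 F = cst 1 by apply/funext => x; rewrite derive1E derive_val.
have cF : continuous F.
  by move=> x; apply/differentiable_continuous/derivable1_diffP/ex_derive.
rewrite /Rintegral (@integration_by_substitution_increasing _ F f)//.
- by congr fine; apply: eq_integral => x _; rewrite dF1 /= mulr1.
- by move=> x y _ _; rewrite /F ltrD2r.
- by rewrite dF1 => x _; apply: cvg_cst.
- by rewrite dF1; apply: is_cvg_cst.
- by rewrite dF1; apply: is_cvg_cst.
- split; first by move=> x _; apply: ex_derive.
  + by apply: cvg_at_right_filter; apply: cF.
  + by apply: cvg_at_left_filter; apply: cF.
- exact: continuous_within_itv.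
Qed.

(** For [T] between [n L] and [(n + 1) L] the integral over [[- T, T]] lies
    between the integrals over [2 n] and [2 (n + 1)] periods, so it differs from
    its expected value by at most two periods.  Nonnegativity gives the
    monotonicity in [T] that this needs. *)
Lemma mean_value_periodic f L : 0 < L -> continuous f -> (forall t, 0 <= f t) ->
  (forall t, f (t + L) = f t) -> exists c, mean_value f c.
Proof.
move=> L0 cf f0 fL.
have fn n t : f (t + n%:R * L) = f t.
  elim: n t => [|n IH] t; first by rewrite mul0r addr0.
  by rewrite -natr1 mulrDl mul1r addrA fL.
pose I a b := \int[lebesgue_measure]_(t in `[a, b]) f t.
have Ishift a b n : a <= b -> I (a + n%:R * L) (b + n%:R * L) = I a b.
  by move=> ab; rewrite /I Rintegral_shift//; apply: eq_Rintegral => t _.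
have I0 a b : 0 <= I a b by apply: Rintegral_ge0.
have nL n : 0 <= n%:R * L by rewrite mulr_ge0// ltW.
have In n : I 0 (n%:R * L) = n%:R * I 0 L.
  elim: n => [|n IH]; first by rewrite !mul0r /I set_itv1 Rintegral_set1.
  rewrite /I (@Rintegral_split _ _ (n%:R * L))//; last by rewrite -natr1; lra.
  rewrite -/(I _ _) IH -/(I _ _) -natr1 mulrDl mul1r.
  have := Ishift 0 L n (ltW L0); rewrite add0r [L + _]addrC => ->.
  by rewrite mulrDl mul1r.
have IN n : I (- (n%:R * L)) (n%:R * L) = 2 * n%:R * I 0 L.
  rewrite /I (@Rintegral_split _ _ 0) ?oppr_le0// -/(I _ _) -/(I _ _).
  have := Ishift (- (n%:R * L)) 0 n; rewrite oppr_le0 addNr add0r In => <- //.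
  by rewrite -/(I 0 L); ring.
have Imono a b : 0 <= a -> a <= b -> I (- a) a <= I (- b) b.
  move=> a0 ab; rewrite /I (@Rintegral_split _ (- b) (- a))//; [|lra..].
  rewrite (@Rintegral_split _ (- a) a b)//; [|lra..].
  by have := I0 (- b) (- a); have := I0 a b; rewrite /I; lra.
exists (I 0 L / L); apply: (@mean_value_bounded_error _ _ (2 * I 0 L)) => // T T0.
have T0' : 0 <= T / L by rewrite divr_ge0// ltW.
have := truncn_itv T0'; set n := Num.truncn _ => /andP[nT Tn].
have lo : I (- (n%:R * L)) (n%:R * L) <= I (- T) T.
  by apply: Imono => //; rewrite -ler_pdivlMr.
have hi : I (- T) T <= I (- (n.+1%:R * L)) (n.+1%:R * L).
  by apply: Imono; [exact: ltW|rewrite -ler_pdivrMr// ltW].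
rewrite -/(I _ _).
have -> : 2 * T * (I 0 L / L) = 2 * (T / L) * I 0 L by field; lra.
move: lo hi; rewrite !IN => lo hi.
have J0 := I0 0 L.
have h1 : n%:R * I 0 L <= T / L * I 0 L by rewrite ler_wpM2r.
have h2 : T / L * I 0 L <= n.+1%:R * I 0 L by rewrite ler_wpM2r// ltW.
move: h2 hi; rewrite -natr1 => h2 hi.
rewrite ler_norml; apply/andP; split; nra.
Qed.

End Mean.

(** * Trigonometric sums and their mean square *)

Section Modulus.
Context {R : realType}.
Implicit Types (z w : R[i]) (x y : R).

Lemma cmodE z : cmod z = Num.sqrt (complex.Re z ^+ 2 + complex.Im z ^+ 2).
Proof. by rewrite /cmod normc_def. Qed.

Lemma cmod_ge0 z : 0 <= cmod z.
Proof. by rewrite cmodE sqrtr_ge0. Qed.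

Lemma sqr_cmod z : cmod z ^+ 2 = complex.Re z ^+ 2 + complex.Im z ^+ 2.
Proof. by rewrite cmodE sqr_sqrtr// addr_ge0// sqr_ge0. Qed.

Lemma cmodC z : (cmod z)%:C = `|z|.
Proof. by rewrite /cmod normc_def. Qed.

Lemma cmodM z w : cmod (z * w) = cmod z * cmod w.
Proof. by apply: complexI; rewrite rmorphM /= !cmodC normrM. Qed.

Lemma cmodX z n : cmod (z ^+ n) = cmod z ^+ n.
Proof. by apply: complexI; rewrite rmorphXn /= !cmodC normrX. Qed.

Lemma cmodD_le z w : cmod (z + w) <= cmod z + cmod w.
Proof. by rewrite -lecR rmorphD /= !cmodC ler_normD. Qed.

Lemma cmodN z : cmod (- z) = cmod z.
Proof. by apply: complexI; rewrite !cmodC normrN. Qed.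

Lemma cmod_nat n : cmod (n%:R : R[i]) = n%:R.
Proof. by apply: complexI; rewrite cmodC rmorph_nat normr_nat. Qed.

Lemma cmod_sum_le (I : Type) (s : seq I) (F : I -> R[i]) :
  cmod (\sum_(i <- s) F i) <= \sum_(i <- s) cmod (F i).
Proof.
rewrite -lecR cmodC rmorph_sum /=; apply: le_trans (ler_norm_sum _ _ _) _.
by under [leRHS]eq_bigr do rewrite cmodC.
Qed.

(** The point of the unit circle with argument [x]. *)
Definition cis x : R[i] := cos x +i* sin x.

Lemma cisD x y : cis (x + y) = cis x * cis y.
Proof.
rewrite /cis cosD sinD; apply/eqP; rewrite eq_complex /=.
by apply/andP; split; apply/eqP => //; ring.
Qed.

Lemma ReD z w : complex.Re (z + w) = complex.Re z + complex.Re w.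
Proof. by case: z w => [a b] [c d]. Qed.

Lemma ImD z w : complex.Im (z + w) = complex.Im z + complex.Im w.
Proof. by case: z w => [a b] [c d]. Qed.

Lemma cis0 : cis 0 = 1.
Proof. by rewrite /cis cos0 sin0. Qed.

Lemma cisM_nat x n : cis (n%:R * x) = cis x ^+ n.
Proof.
elim: n => [|n IH]; first by rewrite mul0r cis0 expr0.
by rewrite -natr1 mulrDl mul1r cisD IH exprSr.
Qed.

Lemma cmod_cis x : cmod (cis x) = 1.
Proof. by rewrite cmodE /= cos2Dsin2 sqrtr1. Qed.

Lemma cis_2pi x : cis (x + 2 * pi) = cis x.
Proof. by rewrite /cis [2 * _]mulr_natl sinD2pi cosD2pi. Qed.

Lemma cexp_imaginary x y : cexp (- x%:C * (0 +i* y)) = cis (- x * y).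
Proof.
have -> : - x%:C * (0 +i* y) = 0 +i* (- x * y).
  by apply/eqP; rewrite eq_complex /=; apply/andP; split; apply/eqP; ring.
by rewrite /cexp /= expR0 mul1r.
Qed.

Lemma dirichlet_poly_imaginary (lam : nat -> R) (A : {fset nat}) a t :
  dirichlet_poly lam A a (0 +i* t) = \sum_(n <- A) a n * cis (- lam n * t).
Proof. by apply: eq_bigr => n _; rewrite cexp_imaginary. Qed.

Lemma sqr_cmodD z w :
  cmod (z + w) ^+ 2 = cmod z ^+ 2 + cmod w ^+ 2 + 2 * complex.Re (z * w^*%C).
Proof. by rewrite !sqr_cmod; case: z w => [a b] [c d] /=; ring. Qed.

Lemma continuous_add (f g : R -> R) :
  continuous f -> continuous g -> continuous (fun t : R => f t + g t).
Proof. by move=> cf cg x; apply: cvgD; [exact: cf|exact: cg]. Qed.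

Lemma continuous_mul (f g : R -> R) :
  continuous f -> continuous g -> continuous (fun t : R => f t * g t).
Proof. by move=> cf cg x; apply: cvgM; [exact: cf|exact: cg]. Qed.

Lemma continuous_trig (a b w : R) :
  continuous (fun t : R => a * cos (w * t) + b * sin (w * t)).
Proof.
have cw : continuous (fun t : R => w * t).
  by apply: continuous_mul; [exact: cst_continuous|move=> x; exact: cvg_id].
apply: continuous_add; apply: continuous_mul; try exact: cst_continuous.
  by move=> x; apply: continuous_comp; [exact: cw|exact: continuous_cos].
by move=> x; apply: continuous_comp; [exact: cw|exact: continuous_sin].
Qed.

Lemma continuous_cis_sum (I : Type) (s : seq I) (c : I -> R[i]) (mu : I -> R) :
  continuous (fun t : R => cmod (\sum_(i <- s) c i * cis (mu i * t))).
Proof.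
have cs : forall s, continuous (fun t : R => complex.Re (\sum_(i <- s) c i * cis (mu i * t)))
   /\ continuous (fun t : R => complex.Im (\sum_(i <- s) c i * cis (mu i * t))).
  elim=> [|i r [IHr IHi]].
    split; under eq_fun do rewrite big_nil /=; exact: cst_continuous.
  have kr z (w : R) : continuous (fun t : R => complex.Re (z * cis (w * t))).
    rewrite (_ : (fun _ => _) = (fun t : R => complex.Re z * cos (w * t) +
      - complex.Im z * sin (w * t))); first exact: continuous_trig.
    by apply/funext => t; case: z => p q /=; ring.
  have ki z (w : R) : continuous (fun t : R => complex.Im (z * cis (w * t))).
    rewrite (_ : (fun _ => _) = (fun t : R => complex.Im z * cos (w * t) +
      complex.Re z * sin (w * t))); first exact: continuous_trig.
    by apply/funext => t; case: z => p q /=; ring.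
  split; under eq_fun do rewrite big_cons ?ReD ?ImD.
    by apply: continuous_add => //; apply: kr.
  by apply: continuous_add => //; apply: ki.
under eq_fun do rewrite cmodE; have [cr ci] := cs s.
move=> x; apply: continuous_comp; last exact: sqrt_continuous.
by apply: continuous_add; apply: continuous_mul.
Qed.

(** Parseval for the Bohr mean, by induction on the list of frequencies: the
    cross terms between the new term and the old ones oscillate with nonzero
    frequencies [lam j - lam n]. *)
Lemma mean_value_sqr_cmod (lam : nat -> R) (s : seq nat) (a : nat -> R[i]) :
  injective lam -> uniq s ->
  mean_value (fun t : R => cmod (\sum_(n <- s) a n * cis (- lam n * t)) ^+ 2)
    (\sum_(n <- s) cmod (a n) ^+ 2).
Proof.
move=> lami; elim: s => [_|n s IH /= /andP[ns us]].
  rewrite big_nil; under eq_fun do rewrite big_nil cmodE /= expr0n addr0 sqrtr0 expr0n.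
  exact: mean_value_cst.
rewrite big_cons; under eq_fun do rewrite big_cons sqr_cmodD cmodM cmod_cis mulr1.
rewrite -[X in mean_value _ X]addr0.
apply: mean_valueD; first by apply: mean_valueD; [exact: mean_value_cst|exact: IH].
rewrite -[X in mean_value _ X](mulr0 2); apply: mean_valueZ.
have -> : (fun t : R => complex.Re (a n * cis (- lam n * t) *
     (\sum_(j <- s) a j * cis (- lam j * t))^*%C)) =
  (fun t : R => \sum_(j <- s | j != n)
    (complex.Re (a n * (a j)^*%C) * cos ((lam j - lam n) * t) +
     - complex.Im (a n * (a j)^*%C) * sin ((lam j - lam n) * t))).
  apply/funext => t; rewrite rmorph_sum mulr_sumr raddf_sum /=.
  rewrite [RHS]big_seq_cond [LHS]big_seq; apply: eq_big => j.
    by case: (j \in s) / boolP => // js; apply/esym; apply: contraNneq ns => <-.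
  move=> _; rewrite /cis !mulrBl !mulNr cosB sinB !cosN !sinN.
  by case: (a n) (a j) => [p q] [u v] /=; ring.
rewrite [X in mean_value _ X](_ : 0 = \sum_(j <- s | j != n) 0); last by rewrite big1.
apply: mean_value_sum => j jn; apply: mean_value_trig.
by rewrite subr_eq0; apply: contraNneq jn => /lami ->.
Qed.

End Modulus.

(** * Means of powers and the norms *)

Section Powers.
Context {R : realType}.

(** A negative base has power [1], so for the limit [0] the base must be
    nonnegative along the filter. *)
Lemma cvg_powR (T : Type) (F : set_system T) {FF : Filter F} (g : T -> R) (c r : R) :
  0 < r -> 0 <= c -> (\forall t \near F, 0 <= g t) -> g @ F --> c ->
  (fun t => g t `^ r) @ F --> c `^ r.
Proof.
move=> r0; rewrite le_eqVlt => /predU1P[<-|c0] g0 gc; last first.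
  have cp : {for c, continuous (fun x : R => x `^ r)}.
    apply/differentiable_continuous/derivable1_diffP.
    by apply: derivable_powR; rewrite in_itv/= c0.
  exact: (cvg_comp _ _ gc cp).
rewrite powR0 ?gt_eqF//; apply/cvgrPdist_lt => /= e e0.
have e1 : 0 < e `^ r^-1 by rewrite powR_gt0.
move/cvgrPdist_lt : gc => /(_ _ e1) gc.
near=> t; rewrite sub0r normrN ger0_norm ?powR_ge0//.
have gt0 : 0 <= g t by near: t.
have : `|0 - g t| < e `^ r^-1 by near: t.
rewrite sub0r normrN ger0_norm// => ge.
rewrite [ltRHS](_ : _ = (e `^ r^-1) `^ r); last first.
  by rewrite -powRrM mulVf ?gt_eqF// powRr1// ltW.
by apply: gt0_ltr_powR => //; rewrite nnegrE// powR_ge0.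
Unshelve. all: by end_near. Qed.

Lemma continuous_powR (f : R -> R) r : 0 < r -> continuous f ->
  (forall t, 0 <= f t) -> continuous (fun t : R => f t `^ r).
Proof. by move=> r0 cf f0 x; apply: cvg_powR => //; [apply: nearW|exact: cf]. Qed.

Lemma mean_value_ge0 (f : R -> R) c : (forall t, 0 <= f t) -> mean_value f c -> 0 <= c.
Proof. by move=> f0 fc; apply: (mean_value_le _ (mean_value_cst 0) fc). Qed.

(** The link with the norms: the limit in the definition of the norm has to be
    shown to exist before it can be evaluated. *)
Lemma Hnorm_mean_value (D : R[i] -> R[i]) r c : 0 < r ->
  mean_value (fun t : R => cmod (D (0 +i* t)) `^ r) c -> Hnorm r%:E D = c `^ r^-1.
Proof.
move=> r0 fc; apply/cvg_lim => //; apply: cvg_powR.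
- by rewrite invr_gt0.
- by apply: mean_value_ge0 fc => t; apply: powR_ge0.
- near=> T.
  have T0 : 0 < T by near: T; apply: nbhs_pinfty_gt; rewrite num_real.
  rewrite mulr_ge0 ?invr_ge0//; first by lra.
  by apply: Rintegral_ge0 => t _; apply: powR_ge0.
- exact: fc.2.
Unshelve. all: by end_near. Qed.

End Powers.

(** * Square norm *)

Section Hilbert.
Context {R : realType}.
Implicit Types (lam : nat -> R) (A : {fset nat}) (a : nat -> R[i]).

Lemma frequency_inj lam : frequency lam -> injective lam.
Proof.
move=> [_ mono _] m n; have [mn|mn|//] := ltngtP m n.
  by move=> lmn; have := mono _ _ mn; rewrite lmn ltxx.
by move=> lmn; have := mono _ _ mn; rewrite lmn ltxx.
Qed.

Lemma Hnorm2 lam A a : injective lam ->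
  Hnorm 2%:E (dirichlet_poly lam A a) = Num.sqrt (\sum_(n <- A) cmod (a n) ^+ 2).
Proof.
move=> lami; rewrite (@Hnorm_mean_value _ _ _ (\sum_(n <- A) cmod (a n) ^+ 2)) //.
  by rewrite powR12_sqrt// sumr_ge0// => n _; rewrite sqr_ge0.
under eq_fun do rewrite dirichlet_poly_imaginary powR_mulrn ?cmod_ge0//.
by apply: mean_value_sqr_cmod => //; exact: fset_uniq.
Qed.

Lemma SUCC2 lam : injective lam -> SUCC lam 2%:E.
Proof.
move=> lami; exists 1; split=> // A B eps eps' AB ue ue'.
rewrite mul1r !Hnorm2//.
have card (D : {fset nat}) e : unimodular_on D e ->
    \sum_(n <- D) cmod (e n) ^+ 2 = (#|` D|)%:R.
  move=> u; rewrite big_seq (eq_bigr (fun=> 1)) => [|n nD]; last by rewrite u// expr1n.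
  by rewrite -big_seq card_fset_sum1 natr_sum.
by rewrite !card// ler_wsqrtr// ler_nat fsubset_leq_card.
Qed.

End Hilbert.

(** * Polynomials on the unit circle and the Dirichlet kernel *)

Section CirclePolynomials.
Context {R : realType}.
Implicit Types (e f : nat -> R[i]) (z : R[i]) (b t : R) (M N : nat).

Definition zsum e N z : R[i] := \sum_(0 <= k < N) e k * z ^+ k.

Lemma zsum_cisE e N b t :
  zsum e N (cis (- b * t)) =
  \sum_(k <- index_iota 0 N) e k * cis (- (k%:R * b) * t).
Proof.
by apply: eq_bigr => k _; rewrite -cisM_nat; congr (_ * cis _); ring.
Qed.

Lemma continuous_cmod_zsum e N b :
  continuous (fun t : R => cmod (zsum e N (cis (- b * t)))).
Proof. under eq_fun do rewrite zsum_cisE; exact: continuous_cis_sum. Qed.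

Lemma mean_value_sqr_zsum e N b : b != 0 -> (forall k, cmod (e k) = 1) ->
  mean_value (fun t : R => cmod (zsum e N (cis (- b * t))) ^+ 2) N%:R.
Proof.
move=> b0 e1; under eq_fun do rewrite zsum_cisE.
have lami : injective (fun k : nat => k%:R * b).
  by move=> k l /(mulIf b0)/eqP; rewrite eqr_nat => /eqP.
have := mean_value_sqr_cmod e lami (iota_uniq 0 (N - 0)).
congr mean_value; under eq_bigr do rewrite e1 expr1n.
by rewrite sumr_const_nat subn0.
Qed.

(** For general [r] the mean exists because the function is periodic in [t]
    with period [2 pi / b]. *)
Lemma mean_value_powR_zsum e N b r : 0 < b -> 0 < r ->
  exists c, mean_value (fun t : R => cmod (zsum e N (cis (- b * t))) `^ r) c.
Proof.
move=> b0 r0; apply: (@mean_value_periodic _ _ (2 * pi / b)).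
- by rewrite divr_gt0// mulr_gt0// pi_gt0.
- apply: continuous_powR => //; last by move=> t; exact: cmod_ge0.
  exact: continuous_cmod_zsum.
- by move=> t; exact: powR_ge0.
- move=> t; rewrite -(cis_2pi (- b * (t + 2 * pi / b))).
  by congr (cmod (zsum _ _ (cis _)) `^ _); field; lra.
Qed.

Lemma cmod1_zpow z k : cmod z = 1 -> cmod (z ^+ k) = 1.
Proof. by move=> z1; rewrite cmodX z1 expr1n. Qed.

Lemma cmod_pow_sub1 z k : cmod z = 1 -> cmod (z ^+ k - 1) <= k%:R * cmod (z - 1).
Proof.
move=> z1; rewrite subrX1 cmodM mulrC; apply: ler_wpM2r; first exact: cmod_ge0.
apply: le_trans (cmod_sum_le _ _) _.
under eq_bigr do rewrite cmod1_zpow//.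
by rewrite sumr_const card_ord.
Qed.

(** Either [z] is within [1 / (2 M)] of [1], where the [M] terms of the short
    kernel are still almost aligned, or the closed form [(z ^ N - 1) / (z - 1)]
    bounds the long kernel independently of [N]. *)
Lemma dirichlet_kernel_dichotomy z M N : cmod z = 1 -> (0 < M)%N ->
  M%:R / 2 <= cmod (zsum (fun=> 1) M z) \/ cmod (zsum (fun=> 1) N z) <= 4 * M%:R.
Proof.
move=> z1 M0; have M0' : 0 < M%:R :> R by rewrite ltr0n.
have D1 L : zsum (fun=> 1) L z = \sum_(k < L) z ^+ k.
  by rewrite /zsum big_mkord; apply: eq_bigr => k _; rewrite mul1r.
have [zM|zM] := leP (cmod (z - 1)) (2 * M%:R)^-1; [left|right].
  have : cmod (M%:R : R[i]) <= cmod (zsum (fun=> 1) M z) +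
      cmod (\sum_(k < M) (z ^+ k - 1)).
    rewrite -[X in _ + X]cmodN; apply: le_trans (cmodD_le _ _).
    by rewrite D1 sumrB sumr_const card_ord opprB addrCA subrr addr0.
  rewrite cmod_nat => h.
  have : cmod (\sum_(k < M) (z ^+ k - 1)) <= M%:R / 2.
    apply: le_trans (cmod_sum_le _ _) _.
    apply: (@le_trans _ _ (\sum_(k < M) 2^-1)).
      apply: ler_sum => k _; apply: le_trans (cmod_pow_sub1 _ z1) _.
      apply: (@le_trans _ _ (M%:R * (2 * M%:R)^-1)).
        by apply: ler_pM; rewrite ?ler0n ?cmod_ge0 ?ler_nat ?(ltnW (ltn_ord k)).
      by rewrite le_eqVlt; apply/orP; left; apply/eqP; field; lra.
    by rewrite sumr_const card_ord -[leLHS]mulr_natl.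
  lra.
have : cmod (z - 1) * cmod (zsum (fun=> 1) N z) <= 2.
  rewrite -cmodM D1 -subrX1; apply: le_trans (cmodD_le _ _) _.
  by rewrite cmodN cmod1_zpow// (cmod_nat 1); lra.
have c0 := cmod_ge0 (zsum (fun=> 1) N z).
have z2M : 1 < 2 * M%:R * cmod (z - 1).
  by rewrite -ltr_pdivrMl ?mulr1//; lra.
move=> h; nra.
Qed.

(** The three terms cover the three cases: [x] above the threshold [K], [x]
    below [K] with [y] large (where the weight [4 y ^ 2 / M ^ 2] is at least 1),
    and [x] bounded by [4 M].  Here [x] and [y] stand for the moduli of the
    kernels with [N] and [M] terms. *)
Lemma powR_split_bound (x y K r s : R) M : 0 < r -> r < s -> 0 < K -> (0 < M)%N ->
  0 <= x -> M%:R / 2 <= y \/ x <= 4 * M%:R ->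
  x `^ r <= K `^ (r - s) * x `^ s + K `^ r * 4 / M%:R ^+ 2 * y ^+ 2 + (4 * M%:R) `^ r.
Proof.
move=> r0 rs K0 M0 x0 xy; have M0' : 0 < M%:R :> R by rewrite ltr0n.
have t1 : 0 <= K `^ (r - s) * x `^ s by rewrite mulr_ge0// powR_ge0.
have t2 : 0 <= K `^ r * 4 / M%:R ^+ 2 * y ^+ 2.
  by rewrite mulr_ge0 ?sqr_ge0// divr_ge0 ?sqr_ge0// mulr_ge0 ?powR_ge0.
have t3 : 0 <= (4 * M%:R) `^ r by rewrite powR_ge0.
have [Kx|xK] := leP K x.
  have x1 : 0 < x by exact: lt_le_trans Kx.
  suff : x `^ r <= K `^ (r - s) * x `^ s by lra.
  have -> : x `^ r = x `^ (r - s) * x `^ s.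
    by rewrite -powRD ?subrK// (gt_eqF x1) implybT.
  rewrite ler_wpM2r ?powR_ge0//.
  rewrite -(opprB s r) !powRN lef_pV2 ?posrE ?powR_gt0//.
  by apply: ge0_ler_powR => //; rewrite ?nnegrE; lra.
case: xy => [yM|xM].
  suff : x `^ r <= K `^ r * 4 / M%:R ^+ 2 * y ^+ 2 by lra.
  apply: (@le_trans _ _ (K `^ r)).
    by apply: ge0_ler_powR; rewrite ?nnegrE; lra.
  rewrite -!mulrA ler_peMr ?powR_ge0//.
  have -> : 4 * (M%:R ^- 2 * y ^+ 2) = (2 * y / M%:R) ^+ 2 by field; lra.
  rewrite expr_ge1// ?divr_ge0//; [|lra..].
  by rewrite ler_pdivlMr//; lra.
suff : x `^ r <= (4 * M%:R) `^ r by lra.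
by apply: ge0_ler_powR; rewrite ?nnegrE; lra.
Qed.

End CirclePolynomials.

(** * Means of the Dirichlet kernel *)

Section Kernel.
Context {R : realType}.
Implicit Types (e f : nat -> R[i]) (z : R[i]) (b c t r s K : R) (M N m : nat).

Definition unimodular e := forall k, cmod (e k) = 1.

(** The variable runs over the circle at speed [b], the step of the
    progression; it is kept because the means are taken over [t]. *)
Definition zmean b r e N c :=
  mean_value (fun t : R => cmod (zsum e N (cis (- b * t))) `^ r) c.

Lemma unimodular1 : unimodular (fun=> 1).
Proof. by move=> k; exact: (cmod_nat 1). Qed.

Lemma zmean2 b e N : b != 0 -> unimodular e -> zmean b 2 e N N%:R.
Proof.
move=> b0 e1; rewrite /zmean.
under eq_fun do rewrite powR_mulrn ?cmod_ge0//.
exact: mean_value_sqr_zsum.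
Qed.

Lemma zmean_kernel_le b r s K mr ms M N : 0 < b -> 0 < r -> r < s -> 0 < K ->
  (0 < M)%N -> zmean b r (fun=> 1) N mr -> zmean b s (fun=> 1) N ms ->
  mr <= K `^ (r - s) * ms + K `^ r * 4 / M%:R + (4 * M%:R) `^ r.
Proof.
move=> b0 r0 rs K0 M0 hr hs; have M0' : 0 < M%:R :> R by rewrite ltr0n.
have hM := mean_value_sqr_zsum M (lt0r_neq0 b0) unimodular1.
have -> : K `^ r * 4 / M%:R = K `^ r * 4 / M%:R ^+ 2 * M%:R by field; lra.
apply: (mean_value_le _ hr (mean_valueD (mean_valueD (mean_valueZ _ hs)
  (mean_valueZ _ hM)) (mean_value_cst _))) => t /=.
apply: powR_split_bound => //; first exact: cmod_ge0.
exact: dirichlet_kernel_dichotomy (cmod_cis _) M0.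
Qed.

Lemma powR_unbounded r B : 0 < r -> exists2 x : R, 0 < x & B <= x `^ r.
Proof.
move=> r0; have B1 : 0 < Num.max B 1 by rewrite lt_max ltr01 orbT.
exists (Num.max B 1 `^ r^-1); first by rewrite powR_gt0.
by rewrite -powRrM mulVf ?gt_eqF// powRr1 ?(ltW B1)// le_max lexx.
Qed.

(** If the means of orders [r < s] were both of the order that a flat
    polynomial has, a fixed part of the mean of order [r] would come from places
    where the kernel is of size [sqrt N].  But these places concentrate at
    [z = 1] and carry vanishing measure, and large values are controlled by the
    mean of order [s]. *)
Lemma kernel_powers_not_comparable r s c0 B : 0 < r -> r < s -> 0 < c0 ->
  ~ (forall m, exists b mr ms, [/\ 0 < b, zmean b r (fun=> 1) (2 ^ m) mr,
       zmean b s (fun=> 1) (2 ^ m) ms,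
       c0 * Num.sqrt (2 ^ m)%:R `^ r <= mr & ms <= B * Num.sqrt (2 ^ m)%:R `^ s]).
Proof.
move=> r0 rs c00 H.
(* Each of [k], [M] and [m] makes one of the three terms of the splitting at
   most [c0 / 4] times the common power of [sqrt N]. *)
have [k k0 kB] := @powR_unbounded (s - r) (4 * B / c0) ltac:(lra).
have kB' : k `^ (r - s) * B <= c0 / 4.
  rewrite -(opprB s r) powRN mulrC ler_pdivrMr ?powR_gt0//.
  by move: kB; rewrite ler_pdivrMr//; lra.
have kr0 : 0 < k `^ r by rewrite powR_gt0.
pose M := (Num.truncn (16 * k `^ r / c0)).+1.
have M0 : 0 < M%:R :> R by rewrite ltr0n.
have kM : k `^ r * 4 / M%:R <= c0 / 4.
  have : 16 * k `^ r / c0 < M%:R by rewrite truncnS_gt.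
  by rewrite ltr_pdivrMr// ler_pdivrMr//; lra.
have [X X0 hX] := powR_unbounded ((4 * M%:R) `^ r * 4 / c0) r0.
pose m := (Num.truncn (X ^+ 2)).+1.
have Xm : X <= Num.sqrt (2 ^ m)%:R.
  rewrite -(ger0_norm (ltW X0)) -sqrtr_sqr ler_wsqrtr//.
  apply/ltW/(lt_le_trans (truncnS_gt _)); rewrite -/m ler_nat.
  exact/ltnW/ltn_expl.
have [b [mr [ms [b0 hmr hms lo hi]]]] := H m.
move: lo hi; set h := Num.sqrt _ in Xm *; move=> lo hi.
have h0 : 0 < h by exact: lt_le_trans Xm.
have hr0 : 0 < h `^ r by rewrite powR_gt0.
have := zmean_kernel_le b0 r0 rs (mulr_gt0 k0 h0) (ltn0Sn _ : (0 < M)%N) hmr hms.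
rewrite !(powRM _ (ltW k0) (ltW h0)) => main.
have h1 : k `^ (r - s) * h `^ (r - s) * ms <= c0 / 4 * h `^ r.
  apply: (@le_trans _ _ (k `^ (r - s) * h `^ (r - s) * (B * h `^ s))).
    by rewrite ler_wpM2l// mulr_ge0// powR_ge0.
  have -> : k `^ (r - s) * h `^ (r - s) * (B * h `^ s) =
      k `^ (r - s) * B * (h `^ (r - s) * h `^ s) by ring.
  rewrite -powRD ?subrK ?(gt_eqF h0) ?implybT//.
  by rewrite ler_wpM2r// ltW.
have h2 : k `^ r * h `^ r * 4 / M%:R <= c0 / 4 * h `^ r.
  have -> : k `^ r * h `^ r * 4 / M%:R = k `^ r * 4 / M%:R * h `^ r by field; lra.
  by rewrite ler_wpM2r// ltW.
have h3 : (4 * M%:R) `^ r <= c0 / 4 * h `^ r.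
  have : X `^ r <= h `^ r by apply: ge0_ler_powR; rewrite ?nnegrE; lra.
  by move: hX; rewrite ler_pdivrMr//; nra.
have : 0 < c0 * h `^ r by rewrite mulr_gt0.
lra.
Qed.

End Kernel.

(** * Rudin-Shapiro polynomials *)

Section RudinShapiro.
Context {R : realType}.
Implicit Types (e f : nat -> R[i]) (z : R[i]) (b c t r s K : R) (M N m : nat).

Lemma parallelogram z w :
  cmod (z + w) ^+ 2 + cmod (z - w) ^+ 2 = 2 * (cmod z ^+ 2 + cmod w ^+ 2) :> R.
Proof. by rewrite !sqr_cmod; case: z w => [a b] [c d] /=; ring. Qed.

(** The coefficients of [P + z ^ N Q] when [P] has [N] coefficients. *)
Definition splice N e f k := if (k < N)%N then e k else f (k - N)%N.

Lemma zsum_splice e f N z :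
  zsum (splice N e f) (N + N) z = zsum e N z + z ^+ N * zsum f N z.
Proof.
rewrite /zsum (big_cat_nat (n := N))//=; last exact: leq_addr.
congr (_ + _).
  by apply: eq_big_nat => k /andP[_ kN]; rewrite /splice kN.
rewrite -{1}(add0n N) big_addn addnK mulr_sumr; apply: eq_bigr => k _.
by rewrite /splice ltnNge leq_addl /= addnK exprD; ring.
Qed.

(** Going from [(P, Q)] to [(P + z ^ N Q, P - z ^ N Q)] doubles
    [|P| ^ 2 + |Q| ^ 2] on the unit circle by the parallelogram law, and keeps
    the coefficients unimodular. *)
Lemma rudin_shapiro_pair m : exists e f : nat -> R[i],
  [/\ unimodular e, unimodular f & forall z, cmod z = 1 ->
    cmod (zsum e (2 ^ m) z) ^+ 2 + cmod (zsum f (2 ^ m) z) ^+ 2 = 2 * (2 ^ m)%:R].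
Proof.
elim: m => [|m [e [f [e1 f1 ef]]]].
  exists (fun=> 1), (fun=> 1); split; [exact: unimodular1..|] => z _.
  by rewrite /zsum big_nat1 expr0 mulr1 (cmod_nat 1) expr1n; lra.
exists (splice (2 ^ m) e f), (splice (2 ^ m) e (fun k => - f k)); split.
- by move=> k; rewrite /splice; case: ifP.
- by move=> k; rewrite /splice; case: ifP => // _; rewrite cmodN.
- move=> z z1; rewrite expnS mul2n -addnn !zsum_splice.
  have -> : zsum (fun k => - f k) (2 ^ m) z = - zsum f (2 ^ m) z.
    by rewrite /zsum -sumrN; apply: eq_bigr => k _; rewrite mulNr.
  rewrite mulrN parallelogram cmodM cmod1_zpow// mul1r ef// natrD; ring.
Qed.

Lemma rudin_shapiro m : exists2 e : nat -> R[i], unimodular e &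
  forall z, cmod z = 1 -> cmod (zsum e (2 ^ m) z) <= Num.sqrt 2 * Num.sqrt (2 ^ m)%:R.
Proof.
have [e [f [e1 _ ef]]] := rudin_shapiro_pair m; exists e => // z z1.
rewrite -sqrtrM// -[leLHS]ger0_norm ?cmod_ge0// -sqrtr_sqr ler_wsqrtr//.
by rewrite -(ef z z1) lerDl sqr_ge0.
Qed.

Lemma zmean_flat_le b r c e N H : 0 < r ->
  (forall z, cmod z = 1 -> cmod (zsum e N z) <= H) -> zmean b r e N c -> c <= H `^ r.
Proof.
move=> r0 eH hc; apply: (mean_value_le _ hc (mean_value_cst _)) => t /=.
have h := eH _ (cmod_cis (- b * t)).
by apply: ge0_ler_powR => //; rewrite ?nnegrE ?(ltW r0) ?(le_trans _ h) ?cmod_ge0.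
Qed.

(** A bound [H] on the modulus [x] gives [x ^ 2 <= H ^ (2 - r) x ^ r], so the
    known mean square forces a large mean of order [r]. *)
Lemma zmean_flat_ge b r c e N H : b != 0 -> unimodular e -> 0 < r -> r < 2 ->
  (forall z, cmod z = 1 -> cmod (zsum e N z) <= H) -> zmean b r e N c ->
  N%:R <= H `^ (2 - r) * c.
Proof.
move=> b0 e1 r0 r2 eH hc.
apply: (mean_value_le _ (zmean2 N b0 e1) (mean_valueZ _ hc)) => t.
have h := eH _ (cmod_cis (- b * t)).
set x := cmod _ in h *; have x0 : 0 <= x by exact: cmod_ge0.
move: x0; rewrite le_eqVlt => /predU1P[<-|x0].
  by rewrite !powR0 ?mulr0// gt_eqF.
have -> : x `^ 2 = x `^ (2 - r) * x `^ r.
  by rewrite -powRD ?subrK// (gt_eqF x0) implybT.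
rewrite ler_wpM2r ?powR_ge0//.
by apply: ge0_ler_powR => //; rewrite ?nnegrE; lra.
Qed.

End RudinShapiro.

(** * Reduction to an arithmetic progression *)

Section Progressions.
Context {R : realType}.
Implicit Types (lam : nat -> R) (e f : nat -> R[i]).

(** The factor [exp (- i (a + b) t)] common to all terms has modulus 1, which
    leaves a polynomial in [exp (- i b t)].  One set [A] serves for all choices
    of coefficients, as required to compare two of them. *)
Lemma progression_dirichlet_poly lam N :
  large_arithmetic_progressions lam ->
  exists2 b : R, 0 < b & exists A : {fset nat}, forall e, unimodular e ->
    exists2 eps, unimodular_on A eps & forall t,
      cmod (dirichlet_poly lam A eps (0 +i* t)) = cmod (zsum e N (cis (- b * t))).
Proof.
move=> /(_ N) [a [b [b0 sub]]]; exists b => //.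
have ex k : exists n, (k < N)%N -> lam n = a + k.+1%:R * b.
  have [kN|_] := ltnP k N; last by exists 0.
  have [|n _ nk] := sub (a + k.+1%:R * b); first by exists k.+1.
  by exists n.
have [g gP] := choice ex.
have gi : {in iota 0 N &, injective g}.
  move=> k l; rewrite !mem_iota !add0n /= => kN lN gkl.
  have := gP _ kN; rewrite gkl gP// => /addrI/(mulIf (lt0r_neq0 b0)) /eqP.
  by rewrite eqr_nat => /eqP[->].
pose s := map g (iota 0 N).
have us : uniq s by rewrite map_inj_in_uniq ?iota_uniq.
exists [fset n in s]%fset => e e1; exists (fun n => e (index n s)) => [n _|t].
  exact: e1.
rewrite dirichlet_poly_imaginary.
have -> : \sum_(n <- [fset n in s]%fset) e (index n s) * cis (- lam n * t) =
    \sum_(n <- s) e (index n s) * cis (- lam n * t).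
  apply: perm_big; apply: uniq_perm => //.
  by move=> n; rewrite !inE.
rewrite big_map.
have -> : \sum_(k <- iota 0 N) e (index (g k) s) * cis (- lam (g k) * t) =
    cis (- (a + b) * t) * zsum e N (cis (- b * t)).
  rewrite /zsum mulr_sumr /index_iota subn0 [LHS]big_seq [RHS]big_seq.
  apply: eq_bigr => k kN.
  rewrite -cisM_nat mulrCA -cisD /s; congr (e _ * cis _).
    have kN' : (k < N)%N by move: kN; rewrite mem_iota add0n.
    have -> : g k = nth 0 (map g (iota 0 N)) k.
      by rewrite (nth_map 0) ?size_iota// nth_iota.
    by rewrite index_uniq// size_map size_iota.
  by rewrite gP; [rewrite -natr1; ring|move: kN; rewrite mem_iota add0n].
by rewrite cmodM cmod_cis mul1r.
Qed.

End Progressions.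

(** * Failure of SUCC away from the exponent 2 *)

Section Main.
Context {R : realType}.
Implicit Types (lam : nat -> R) (e f : nat -> R[i]).

(** SUCC is used only for equal index sets, on which it bounds the norm of any
    unimodular polynomial by that of any other. *)
Lemma SUCC_zmean lam r : 0 < r -> large_arithmetic_progressions lam ->
  SUCC lam r%:E -> exists2 C, 0 < C & forall N, exists2 b : R, 0 < b &
    forall e f ce cf, unimodular e -> unimodular f ->
      zmean b r e N ce -> zmean b r f N cf -> ce <= C * cf.
Proof.
move=> r0 hAP [C [C0 hC]]; exists (C `^ r); first by rewrite powR_gt0.
move=> N; have [b b0 [A hA]] := progression_dirichlet_poly N hAP.
exists b => // e f ce cf e1 f1 he hf.
have zmean_ge0 g c : zmean b r g N c -> 0 <= c.
  by apply: mean_value_ge0 => t; exact: powR_ge0.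
have norm g c eps : zmean b r g N c ->
    (forall t, cmod (dirichlet_poly lam A eps (0 +i* t)) = cmod (zsum g N (cis (- b * t)))) ->
    Hnorm r%:E (dirichlet_poly lam A eps) = c `^ r^-1.
  move=> hg epsE; apply: (Hnorm_mean_value r0).
  suff -> : (fun t : R => cmod (dirichlet_poly lam A eps (0 +i* t)) `^ r) =
    (fun t : R => cmod (zsum g N (cis (- b * t))) `^ r) by exact: hg.
  by apply/funext => t; rewrite epsE.
have [eps ue epsE] := hA e e1; have [phi uf phiE] := hA f f1.
have := hC A A eps phi (fsubset_refl _) ue uf.
rewrite (norm _ _ _ he epsE) (norm _ _ _ hf phiE) => h.
have root c : 0 <= c -> c = (c `^ r^-1) `^ r.
  by move=> c0; rewrite -powRrM mulVf ?gt_eqF// powRr1.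
rewrite (root ce) ?(zmean_ge0 _ _ he)// [in leRHS](root cf) ?(zmean_ge0 _ _ hf)//.
rewrite -powRM ?powR_ge0 ?(ltW C0)//.
by apply: ge0_ler_powR => //; rewrite ?nnegrE ?mulr_ge0 ?powR_ge0 ?(ltW C0) ?(ltW r0).
Qed.

Lemma SUCC_infty_false lam : large_arithmetic_progressions lam -> ~ SUCC lam +oo%E.
Proof.
move=> hAP [C [C0 hC]].
have bound m : (2 ^ m)%:R <= C * (Num.sqrt 2 * Num.sqrt (2 ^ m)%:R).
  have [b b0 [A hA]] := progression_dirichlet_poly (2 ^ m) hAP.
  have [e e1 eH] := rudin_shapiro (R := R) m.
  have [eps ue epsE] := hA _ unimodular1; have [phi uf phiE] := hA e e1.
  have D0 : cmod (dirichlet_poly lam A eps (0 +i* 0)) = (2 ^ m)%:R.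
    rewrite epsE mulr0 cis0 /zsum; under eq_bigr do rewrite expr1n mulr1.
    by rewrite sumr_const_nat subn0 cmod_nat.
  apply: le_trans (_ : Hnorm +oo%E (dirichlet_poly lam A eps) <= _).
    rewrite -D0; apply: ub_le_sup; last by exists 0.
    exists (2 ^ m)%:R => _ [t _ <-].
    rewrite epsE; apply: le_trans (cmod_sum_le _ _) _.
    rewrite (eq_bigr (fun=> 1)) ?sumr_const_nat ?subn0// => k _.
    by rewrite mul1r cmod1_zpow// cmod_cis.
  apply: le_trans (hC _ _ _ _ (fsubset_refl _) ue uf) _.
  rewrite ler_wpM2l ?(ltW C0)//; apply: ge_sup.
    by exists (cmod (dirichlet_poly lam A phi (0 +i* 0))); exists 0.
  by move=> _ [t _ <-]; rewrite phiE eH// cmod_cis.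
pose m := (Num.truncn (2 * C ^+ 2)).+1.
have N0 : 0 < (2 ^ m)%:R :> R by rewrite ltr0n expn_gt0.
have := bound m; rewrite -sqrtrM// -(@ler_pXn2r _ 2)//; last 2 first.
- by rewrite nnegrE ltW.
- by rewrite nnegrE mulr_ge0 ?sqrtr_ge0 ?(ltW C0).
rewrite exprMn sqr_sqrtr ?mulr_ge0// expr2 mulrA ler_pM2r//.
rewrite mulrC leNgt => /negP; apply.
apply: lt_le_trans (truncnS_gt _) _; rewrite -/m ler_nat.
exact/ltnW/ltn_expl.
Qed.

Lemma SUCC_finite_eq2 lam r : 0 < r -> large_arithmetic_progressions lam ->
  SUCC lam r%:E -> r = 2.
Proof.
move=> r0 hAP /(SUCC_zmean r0 hAP)[C C0 hC].
have s2 : 0 < Num.sqrt 2 :> R by rewrite sqrtr_gt0.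
have h0 m : 0 < Num.sqrt (2 ^ m)%:R :> R by rewrite sqrtr_gt0 ltr0n expn_gt0.
have h2 m : Num.sqrt (2 ^ m)%:R `^ 2 = (2 ^ m)%:R :> R.
  by rewrite powR_mulrn ?sqrtr_ge0// sqr_sqrtr.
have [r2|r2|//] := ltgtP r 2.
(* SUCC makes the mean of order [r < 2] of the kernel as large as that of the
   flat polynomial. *)
- exfalso; apply: (@kernel_powers_not_comparable R r 2
    (C^-1 * (Num.sqrt 2 `^ (2 - r))^-1) 1) => //.
    by rewrite mulr_gt0 ?invr_gt0// powR_gt0.
  move=> m; have [b b0 {}hC] := hC (2 ^ m)%N.
  have [e e1 eH] := rudin_shapiro (R := R) m.
  have [mr hr] := mean_value_powR_zsum (fun=> 1) (2 ^ m) b0 r0.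
  have [me he] := mean_value_powR_zsum e (2 ^ m) b0 r0.
  exists b, mr, (2 ^ m)%:R; split=> //.
  + by apply: zmean2 (unimodular1 (R := R)); rewrite gt_eqF.
  + have := zmean_flat_ge (lt0r_neq0 b0) e1 r0 r2 eH he.
    rewrite powRM ?sqrtr_ge0// -[X in X <= _]h2.
    have -> : Num.sqrt (2 ^ m)%:R `^ 2 =
        Num.sqrt (2 ^ m)%:R `^ (2 - r) * Num.sqrt (2 ^ m)%:R `^ r :> R.
      by rewrite -powRD ?subrK// (gt_eqF (h0 m)) implybT.
    have h1 : 0 < Num.sqrt (2 ^ m)%:R `^ (2 - r) :> R by rewrite powR_gt0.
    rewrite -mulrA mulrCA ler_pM2l// => h.
    rewrite -mulrA ler_pdivrMl// ler_pdivrMl ?powR_gt0//.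
    apply: le_trans h _; rewrite ler_wpM2l ?powR_ge0//.
    exact: hC e1 (unimodular1 (R := R)) he hr.
  + by rewrite mul1r h2.
(* SUCC makes the mean of order [r > 2] of the kernel as small as that of the
   flat polynomial. *)
- exfalso; apply: (@kernel_powers_not_comparable R 2 r 1 (C * Num.sqrt 2 `^ r)) => //.
  move=> m; have [b b0 {}hC] := hC (2 ^ m)%N.
  have [e e1 eH] := rudin_shapiro (R := R) m.
  have [ms hs] := mean_value_powR_zsum (fun=> 1) (2 ^ m) b0 r0.
  have [me he] := mean_value_powR_zsum e (2 ^ m) b0 r0.
  exists b, (2 ^ m)%:R, ms; split=> //.
  + by apply: zmean2 (unimodular1 (R := R)); rewrite gt_eqF.
  + by rewrite mul1r h2.
  + rewrite -mulrA -powRM ?sqrtr_ge0//.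
    apply: le_trans (hC _ _ _ _ (unimodular1 (R := R)) e1 hs he) _.
    by rewrite ler_wpM2l ?(ltW C0)//; exact: zmean_flat_le eH he.
Qed.

End Main.

Theorem proposition5p1 (R : realType) (lam : nat -> R) (p : \bar R)
    (hlam : frequency lam) (hAP : large_arithmetic_progressions lam)
    (hp : (1%:E <= p)%E) :
  SUCC lam p <-> p = 2%:E.
Proof.
split=> [|->]; last exact/SUCC2/frequency_inj.
case: p hp => [r|_ /(SUCC_infty_false hAP)//|//].
rewrite lee_fin => r1 /(SUCC_finite_eq2 (lt_le_trans ltr01 r1) hAP) -> //.
Qed.
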